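(* For every positive integer $m$ there exists a number $\nu(m)$, depending only on $m$, such that the following holds: let $k\ge 1$ and let $n_1,\dots,n_k$ be positive integers, and let $$w=[\dots[x_1^{n_1},x_2]^{n_2},\dots,x_k]^{n_k}.$$ If $G$ is a residually finite group in which $w$ has at most $m$ values (that is, $|G_w|\le m$), then the verbal subgroup $w(G)$ is finite and $|w(G)|\le\nu(m)$.
   Context: A group-word $w=w(x_1,\dots,x_k)$ is an element of the free group on $x_1,\dots,x_k$. For a group $G$, $G_w$ denotes the set of all values $w(g_1,\dots,g_k)$ with $g_1,\dots,g_k\in G$, and the verbal subgroup $w(G)$ is the subgroup of $G$ generated by $G_w$. The commutator is $[a,b]=a^{-1}b^{-1}ab$. The word $w=[\dots[x_1^{n_1},x_2]^{n_2},\dots,x_k]^{n_k}$ is defined recursively: $v_1=x_1^{n_1}$, $v_j=[v_{j-1},x_j]^{n_j}$ for $2\le j\le k$, and $w=v_k$. *)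

(* Defs.v *)
From HB Require Import structures.
From mathcomp Require Import all_boot fingroup.
From mathcomp Require Import boolp classical_sets functions cardinality.

Set Implicit Arguments.
Unset Strict Implicit.
Unset Printing Implicit Defensive.

Local Open Scope classical_set_scope.
Local Open Scope group_scope.

(* The free group on X is realized by reduced words. A letter (x, false)
   stands for x and (x, true) for x^-1. *)

Definition invl (X : Type) (a : X * bool) : X * bool := (a.1, ~~ a.2).

Definition reduced (X : eqType) (s : seq (X * bool)) : bool :=
  sorted (fun a b => b != invl a) s.

Definition push (X : eqType) (a : X * bool) (s : seq (X * bool)) :=
  if s is b :: s' then if b == invl a then s' else a :: s else [:: a].

Definition redmul (X : eqType) (s t : seq (X * bool)) := foldr (@push X) t s.

Definition redinv (X : Type) (s : seq (X * bool)) := rev (map (@invl X) s).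

Lemma invlK (X : Type) : involutive (@invl X).
Proof. by case=> x b; rewrite /invl /= negbK. Qed.

Lemma reduced_push (X : eqType) (a : X * bool) s :
  reduced s -> reduced (push a s).
Proof.
case: s => [|b s] //= rs; case: ifPn => [_|nab] /=; last by rewrite nab.
exact: path_sorted rs.
Qed.

Lemma push_reduced (X : eqType) (a : X * bool) s :
  reduced (a :: s) -> push a s = a :: s.
Proof. by case: s => [|b s] //= /andP[/negPf ->]. Qed.

Lemma pushK (X : eqType) (a : X * bool) s :
  reduced s -> push a (push (invl a) s) = s.
Proof.
case: s => [|b s] /=; first by rewrite eqxx.
rewrite invlK; have [->|_ _] := eqVneq b a; last by rewrite /= eqxx.
exact: push_reduced.
Qed.

Lemma reduced_mul (X : eqType) (s t : seq (X * bool)) :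
  reduced t -> reduced (redmul s t).
Proof. by move=> rt; elim: s => //= a s; apply: reduced_push. Qed.

Lemma redmul_push (X : eqType) (a : X * bool) s t :
  reduced t -> redmul (push a s) t = push a (redmul s t).
Proof.
move=> rt; case: s => [|b s] //=; case: eqP => [->|] //=.
by rewrite pushK // reduced_mul.
Qed.

Lemma redmulA (X : eqType) (s t u : seq (X * bool)) :
  reduced u -> redmul s (redmul t u) = redmul (redmul s t) u.
Proof. by move=> ru; elim: s => //= a s ->; rewrite redmul_push. Qed.

Lemma redmul1 (X : eqType) (s : seq (X * bool)) :
  reduced s -> redmul s [::] = s.
Proof.
elim: s => //= a s IHs rs.
by rewrite IHs ?push_reduced //; apply: path_sorted rs.
Qed.

Lemma reduced_inv (X : eqType) (s : seq (X * bool)) :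
  reduced s -> reduced (redinv s).
Proof.
rewrite /reduced /redinv rev_sorted sorted_map; apply: sub_sorted => a b /=.
by rewrite invlK; apply: contra => /eqP ->.
Qed.

Lemma redinvK (X : Type) : involutive (@redinv X).
Proof. by move=> s; rewrite /redinv map_rev revK (mapK (@invlK X)). Qed.

Lemma redmulVg (X : eqType) (s : seq (X * bool)) : redmul (redinv s) s = [::].
Proof.
elim: s => //= a s IHs.
by rewrite /redinv /= rev_cons /redmul foldr_rcons /= invlK eqxx.
Qed.

Record free_group (X : choiceType) : Type := FreeGroup {
  letters :> seq (X * bool);
  letters_reduced : reduced letters
}.

HB.instance Definition _ (X : choiceType) := [isSub for @letters X].
HB.instance Definition _ (X : choiceType) := [Choice of free_group X by <:].

Definition free_one (X : choiceType) : free_group X :=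
  @FreeGroup X [::] isT.

Definition free_mul (X : choiceType) (u v : free_group X) : free_group X :=
  FreeGroup (reduced_mul u (letters_reduced v)).

Definition free_inv (X : choiceType) (u : free_group X) : free_group X :=
  FreeGroup (reduced_inv (letters_reduced u)).

Lemma free_mulA (X : choiceType) : associative (@free_mul X).
Proof. by move=> u v w; apply/val_inj/redmulA/letters_reduced. Qed.

Lemma free_mul1g (X : choiceType) : left_id (@free_one X) (@free_mul X).
Proof. by move=> u; apply: val_inj. Qed.

Lemma free_mulg1 (X : choiceType) : right_id (@free_one X) (@free_mul X).
Proof. by move=> u; apply/val_inj/redmul1/letters_reduced. Qed.

Lemma free_mulVg (X : choiceType) :
  left_inverse (@free_one X) (@free_inv X) (@free_mul X).
Proof. by move=> u; apply/val_inj/redmulVg. Qed.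

Lemma free_mulgV (X : choiceType) :
  right_inverse (@free_one X) (@free_inv X) (@free_mul X).
Proof.
move=> u; apply: val_inj => /=.
by rewrite -{1}(redinvK (letters u)) redmulVg.
Qed.

HB.instance Definition _ (X : choiceType) :=
  isGroup.Build (free_group X) (@free_mulA X) (@free_mul1g X) (@free_mulg1 X)
    (@free_mulVg X) (@free_mulgV X).

Definition free_gen (X : choiceType) (x : X) : free_group X :=
  @FreeGroup X [:: (x, false)] isT.

Definition word_eval (X : choiceType) (G : groupType) (g : X -> G)
    (w : free_group X) : G :=
  \prod_(a <- letters w) (if a.2 then (g a.1)^-1 else g a.1).

(* word_eval g is the homomorphism from the free group extending g. *)

Lemma word_eval_gen (X : choiceType) (G : groupType) (g : X -> G) (x : X) :
  word_eval g (free_gen x) = g x.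
Proof. by rewrite /word_eval big_seq1. Qed.

Lemma word_evalM (X : choiceType) (G : groupType) (g : X -> G) :
  {morph word_eval g : u v / u * v}.
Proof.
move=> u v; rewrite /word_eval /= /redmul.
elim: (letters u) => [|a s IHs] /=; first by rewrite big_nil mul1g.
rewrite big_cons -mulgA -IHs.
case: (foldr _ _ _) => [|b r] /=; first by rewrite big_seq1 big_nil mulg1.
case: eqP => [->|_]; last by rewrite big_cons.
by rewrite big_cons /=; case: a.2; rewrite /= ?mulKg ?mulVKg.
Qed.

Section Words.
Context (X : choiceType) (w : free_group X) (G : groupType).

Definition word_values : set G := range (fun g : X -> G => word_eval g w).

Definition verbal_subgroup : set G :=
  smallest [set H : set G | group_closed (mem H)] word_values.

End Words.
Arguments word_values {X} w G.
Arguments verbal_subgroup {X} w G.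

Definition residually_finite (G : groupType) : Prop :=
  forall x : G, x <> 1 ->
    exists (H : finGroupType) (f : {multiplicative G -> H}), f x <> 1.

(* Variables and exponents are numbered from 0: power_comm_rec n j is
   v_(j+1) = [v_j, x_(j+1)]^n_(j+1), a word in x_1, ..., x_(k+1). *)
Fixpoint power_comm_rec (k : nat) (n : 'I_k.+1 -> nat) (j : nat) :
    free_group 'I_k.+1 :=
  if j is i.+1
  then [~ power_comm_rec n i, free_gen (inord j)] ^+ n (inord j)
  else free_gen ord0 ^+ n ord0.

Definition power_comm_word (k : nat) (n : 'I_k.+1 -> nat) :
    free_group 'I_k.+1 :=
  power_comm_rec n k.

(* Main.v *)
From HB Require Import structures.
Require Import Defs.
From mathcomp Require Import all_boot fingroup.
From mathcomp Require Import boolp classical_sets functions cardinality.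
From mathcomp Require Import ssralg ssrnum action cyclic matrix.
From mathcomp Require Import algC algnum mxrepresentation classfun character.

(** The proof follows Guralnick and Shumyatsky. Call a set S of elements of a
    finite group K power-closed if x ^+ e is in S for all x in S and all e
    coprime to #|K|.

    1. In every finite group K the set of values of w is power-closed.
    This is clear for x_1^n_1, and it passes from v to [v, x]^n because
    [a, b]^e is conjugate to a commutator [a^e, d] ([commg_expg_class]). The
    latter is a theorem of character theory: the number of y such that [a, y]
    is conjugate to x is, up to a nonzero factor, the sum over the irreducible
    characters chi of chi(a^-1) chi(a) chi(x^-1) / chi(1). A field automorphism
    raising the #|K|-th roots of unity to the power e turns the sum for a and x
    into the sum for a^e and x^e, so both are nonzero at the same time.

    2. Hence a value x of w in K has all generators of <[x]> among the at most
    m values, that is, totient #[x] <= m. Every prime power exactly dividing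
    #[x] is then at most 2m, so #[x] divides (2m)! ([order_dvd_fact]).

    3. If G is residually finite with at most m values, each value x satisfies
    x^(2m)! = 1, since this holds in all finite images of G
    ([word_value_expg_fact]).

    4. The values form a finite set, stable under conjugation, of elements of
    bounded order. By the argument of Dietzmann's lemma, every product of values
    is a product of at most m * (2m)! of them ([prod_shorten]), so the verbal
    subgroup has at most m ^ (m * (2m)!) elements. *)

Set Implicit Arguments.
Unset Strict Implicit.
Unset Printing Implicit Defensive.

Import GRing.Theory Num.Theory.
Local Open Scope card_scope.
Local Open Scope classical_set_scope.
Local Open Scope group_scope.

(** * Powers of commutators in finite groups *)

Section CharacterSums.
Variables (gT : finGroupType) (G : {group gT}).

(** The class sum of h is central in the group algebra, so by Schur's lemma it
    acts on an irreducible module as a scalar, whose value is read off from its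
    trace. *)
Lemma irr_sum_conj (i : Iirr G) g h : g \in G -> h \in G ->
  (\sum_(y in G) 'chi_i (g * h ^ y)%g
   = #|G|%:R * 'chi_i g * 'chi_i h / 'chi_i 1%g)%R.
Proof.
move=> Gg Gh; pose rho := 'Chi_i.
have rhoE x : x \in G -> ('chi_i x = \tr (rho x))%R.
  by move=> Gx; rewrite -irrRepr cfunE Gx mulr1n.
have irr_rho : mx_irreducible rho := socle_irr _.
clearbody rho; pose M := (\sum_(y in G) rho (h ^ y)%g)%R.
have /is_scalar_mxP[c Mc]: is_scalar_mx M.
  have /mx_abs_irr_cent_scalar : mx_absolutely_irreducible rho.
    exact: groupC.
  apply; apply/centgmxP => x Gx.
  rewrite mulmx_suml mulmx_sumr [RHS](reindex_acts 'R _ Gx) ?astabsR //=.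
  apply: eq_bigr => y Gy.
  rewrite -!repr_mxM ?groupJ ?groupM //.
  by rewrite conjgM conjgC.
have chi_h : (c * 'chi_i 1%g = #|G|%:R * 'chi_i h)%R.
  transitivity (\tr M)%R.
    by rewrite Mc mxtrace_scalar rhoE // repr_mx1 mxtrace1 mulr_natr.
  rewrite raddf_sum /= mulr_natl -sumr_const; apply: eq_bigr => y Gy.
  by rewrite -rhoE ?groupJ // cfunJ.
transitivity (\tr (rho g *m M))%R.
  rewrite mulmx_sumr raddf_sum; apply: eq_bigr => y Gy /=.
  by rewrite rhoE ?repr_mxM ?in_group.
rewrite Mc mul_mx_scalar mxtraceZ -rhoE //.
apply: (canRL (mulfK (irr1_neq0 i))).
by rewrite mulrAC chi_h mulrAC.
Qed.

(** The eigenvalues of x are #|G|-th roots of unity, and those of x ^+ e are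
    their e-th powers. *)
Lemma aut_irr_expg e (i : Iirr G) x (u : {rmorphism algC -> algC}) :
    (forall z, (z ^+ #|G| = 1)%R -> u z = (z ^+ e)%R) ->
  x \in G -> (u ('chi_i x) = 'chi_i (x ^+ e)%g)%R.
Proof.
move=> uE Gx.
have [d [[B uB rx] [d1 _] [chix _] _]] := repr_rsim_diag 'Chi_i Gx.
have rxe :
  ('Chi_i (x ^+ e)%g = invmx B *m diag_mx (\row_j d ord0 j ^+ e) *m B)%R.
  elim: e {uE} => [|e IHe].
    rewrite expg0 repr_mx1 (_ : diag_mx _ = 1%:M)%R ?mulmx1 ?mulVmx //.
    by apply/matrixP=> j k; rewrite !mxE expr0.
  rewrite expgS repr_mxM ?groupX // rx IHe !mulmxA mulmxK //.
  rewrite -!mulmxA [(diag_mx d *m _)%R]mulmxA mulmx_diag.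
  congr (_ *m (diag_mx _ *m _))%R.
  by apply/rowP=> j; rewrite !mxE exprS.
rewrite -[in RHS]irrRepr cfunE groupX // mulr1n rxe mxtrace_mulC.
rewrite mulmxA mulmxV // mul1mx mxtrace_diag -irrRepr chix rmorph_sum.
apply: eq_bigr => j _; rewrite mxE uE //.
by have /dvdnP[q ->] := order_dvdG Gx; rewrite mulnC exprM d1 expr1n.
Qed.

(** A refinement of Honda's theorem that coprime powers of commutators are
    commutators: it keeps track of the first entry, which has to remain a value
    of a given word. *)
Lemma commg_expg_class e a b : coprime e #|G| -> a \in G -> b \in G ->
  exists c d, [/\ c \in G, d \in G & [~ a, b] ^+ e = [~ (a ^+ e) ^ c, d]].
Proof.
move=> co_e Ga Gb; have [u uE] := Qn_aut_exists co_e.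
(* By second orthogonality, N a x is a positive multiple of the number of y in
   G such that [~ a, y] is conjugate to x. *)
pose N a x : algC :=
  (\sum_(y in G) \sum_i 'chi[G]_i [~ a, y]%g * ('chi_i x)^* )%R.
have NE a' x : a' \in G -> x \in G ->
    (N a' x = \sum_i #|G|%:R * 'chi[G]_i a'^-1%g * 'chi_i a' / 'chi_i 1%g
                * 'chi_i x^-1%g)%R.
  move=> Ga' Gx; rewrite /N exchange_big /=; apply: eq_bigr => i _.
  by rewrite -mulr_suml (irr_inv i x) -irr_sum_conj ?groupV.
have Nu x : x \in G -> u (N a x) = N (a ^+ e) (x ^+ e).
  move=> Gx; rewrite !NE ?groupX // rmorph_sum; apply: eq_bigr => i _.
  rewrite !rmorphM fmorphV rmorph_nat /= !(aut_irr_expg _ uE) ?groupV //.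
  by rewrite !expVgn expg1n.
have Gab : [~ a, b] \in G by rewrite groupR.
have N2 a' x : x \in G ->
    (N a' x
     = \sum_(y in G) #|'C_G[[~ a', y]]|%:R *+ ([~ a', y]%g \in x ^: G))%R.
  by move=> Gx; apply: eq_bigr => y _; rewrite second_orthogonality_relation.
have: (N (a ^+ e)%g ([~ a, b] ^+ e)%g != 0)%R.
  rewrite -Nu // fmorph_eq0 N2 //.
  rewrite psumr_neq0 => [|y _]; last by rewrite mulrn_wge0 ?ler0n.
  apply/hasP; exists b; rewrite ?mem_index_enum //= Gb class_refl.
  by rewrite ltr0n cardG_gt0.
rewrite N2 ?groupX //; have [y /andP[Gy /imsetP[c Gc Dc]] _|no] :=
  pickP [pred y in G | [~ a ^+ e, y] \in ([~ a, b] ^+ e) ^: G].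
  exists c^-1, (y ^ c^-1); rewrite groupV groupJ ?groupV //; split=> //.
  by rewrite -conjRg Dc conjgK.
rewrite big1 ?eqxx // => y Gy.
by move/negbT: (no y); rewrite /= Gy /= => /negPf->.
Qed.

End CharacterSums.

(** * Bounding the order of an element by its number of generators *)

(** It suffices that each prime power p ^ a exactly dividing n is at most 2m,
    and p ^ a <= 2 (p - 1) p ^ (a - 1) = 2 totient (p ^ a) <= 2 totient n. *)
Lemma dvdn_fact_totient n m : 0 < n -> totient n <= m -> n %| (m.*2)`!.
Proof.
move=> n_gt0 phin_le; apply/dvdn_partP => // p.
rewrite mem_primes => /and3P[p_pr _ p_dv_n].
apply: dvdn_fact; rewrite part_gt0 /=.
have a_gt0 : 0 < logn p n by rewrite logn_gt0 mem_primes p_pr n_gt0.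
have phi_part : totient n`_p <= totient n.
  rewrite -[in X in _ <= X](partnC p n_gt0) totient_coprime ?coprime_partC //.
  by rewrite leq_pmulr // totient_gt0 part_gt0.
apply: (@leq_trans (totient n`_p).*2).
  2: by rewrite leq_double (leq_trans phi_part).
rewrite p_part totient_pfactor // -[in X in X <= _](prednK a_gt0) expnS.
rewrite doubleMl leq_mul // -addnn.
case: p p_pr {p_dv_n a_gt0 phi_part} => [|[|p]] // _.
by rewrite addSn ltnS leq_addl.
Qed.

(** Solve e' = e modulo n and e' = 1 modulo the part of N prime to n. *)
Lemma coprime_lift e n N : 0 < n -> 0 < N -> coprime n e ->
  exists2 e', e' = e %[mod n] & coprime e' N.
Proof.
move=> n_gt0 N_gt0 co_ne; pose q := (N`_(\pi(n)^'))%N.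
have co_nq : coprime n q by rewrite coprime_pi' ?part_gt0 ?part_pnat.
(* The summand n * q only serves to make e' positive. *)
pose e' := (n * q + chinese n q e 1)%N.
have e'n : e' = e %[mod n] by rewrite /e' mulnC modnMDl chinese_modl.
have e'q : e' = 1 %[mod q] by rewrite /e' modnMDl chinese_modr.
exists e' => //.
have e'_gt0 : 0 < e' by rewrite addn_gt0 muln_gt0 n_gt0 part_gt0.
rewrite coprime_sym -(partnC \pi(n) N_gt0) coprimeMl; apply/andP; split.
  apply: (@pnat_coprime \pi(n)); rewrite ?part_pnat // -coprime_pi' //.
  by rewrite -coprime_modr e'n coprime_modr.
by rewrite -coprime_modr e'q coprime_modr coprimen1.
Qed.

(** Each generator of <[x]> is a power x ^+ e with e coprime to #|K|, since an
    exponent coprime to #[x] can be changed modulo #[x]; so S contains all the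
    totient #[x] generators. *)
Lemma order_dvd_fact (gT : finGroupType) (K : {group gT}) (S : {set gT}) x m :
    x \in K -> (forall e, coprime e #|K| -> x ^+ e \in S) -> #|S| <= m ->
  #[x] %| (m.*2)`!.
Proof.
move=> Kx Sx S_le; apply: dvdn_fact_totient; rewrite ?order_gt0 //.
rewrite totient_gen; apply: leq_trans S_le; apply: subset_leq_card.
apply/fintype.subsetP => y; rewrite inE => gen_y.
have /cycleP[e Dy] := cycle_generator gen_y.
rewrite Dy generator_coprime in gen_y *.
have [e' De' co_e'] := coprime_lift (order_gt0 x) (cardG_gt0 K) gen_y.
by rewrite -(expg_mod_order x e) -De' expg_mod_order Sx.
Qed.

(** * Values of the power-commutator word in a finite group *)

Section PowerCommValues.
Variables (gT : finGroupType) (K : {group gT}) (n : nat -> nat).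

(** The values of the word in K, described inside the ambient finite group; K
    itself is only a subgroup, because the finite images of an infinite group
    come as images of morphisms that need not be surjective. *)
Fixpoint power_comm_values (j : nat) : {set gT} :=
  if j is i.+1
  then [set [~ a, b] ^+ n j | a in power_comm_values i, b in K]%SET
  else [set a ^+ n 0 | a in K]%SET.

Lemma power_comm_values_sub j x : x \in power_comm_values j -> x \in K.
Proof.
elim: j x => [|j IHj] x /=; first by case/imsetP=> a Ka ->; rewrite groupX.
by case/imset2P=> a b /IHj Ka Kb ->; rewrite groupX // groupR.
Qed.

Lemma power_comm_valuesJ j x c :
  x \in power_comm_values j -> c \in K -> x ^ c \in power_comm_values j.
Proof.
move=> + Kc; elim: j x => [|j IHj] x /=.
  case/imsetP=> a Ka ->; apply/imsetP.
  by exists (a ^ c); rewrite ?conjXg ?groupJ.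
case/imset2P=> a b Va Kb ->.
rewrite conjXg conjRg; apply/imset2P.
by exists (a ^ c) (b ^ c); rewrite ?groupJ // IHj.
Qed.

Lemma power_comm_valuesX j x e :
  coprime e #|K| -> x \in power_comm_values j -> x ^+ e \in power_comm_values j.
Proof.
move=> co_e; elim: j x => [|j IHj] x /=.
  case/imsetP=> a Ka ->; rewrite expgAC; apply/imsetP.
  by exists (a ^+ e); rewrite ?groupX.
case/imset2P=> a b Va Kb ->; rewrite expgAC.
have [c [d [Kc Kd ->]]] := commg_expg_class co_e (power_comm_values_sub Va) Kb.
apply/imset2P; exists ((a ^+ e) ^ c) d => //.
by rewrite power_comm_valuesJ // IHj.
Qed.

End PowerCommValues.

(** * Values of words and homomorphisms *)

Section WordValues.
Variables (X : choiceType) (G : groupType).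
Implicit Types (w : free_group X) (g : X -> G).

HB.instance Definition _ g :=
  isMultiplicative.Build _ _ (@word_eval X G g) (word_evalM g).
HB.instance Definition _ g :=
  Multiplicative_isUMagmaMorphism.Build _ _ (@word_eval X G g)
    (big_nil _ _ _ _ : word_eval g 1 = 1).

Lemma word_values1 w : word_values w G 1.
Proof.
exists (fun=> 1) => //; rewrite /word_eval big1 // => a _.
by rewrite invg1 if_same.
Qed.

Lemma word_valuesJ w x c : word_values w G x -> word_values w G (x ^ c).
Proof.
case=> g _ <-; exists (fun v => g v ^ c) => //.
rewrite /word_eval conjg_prod; apply: eq_bigr => a _.
by rewrite -conjVg; case: a.2.
Qed.

End WordValues.

(** * Transfer from finite images to residually finite groups *)

Section PowerCommWord.
Variables (k : nat) (n : 'I_k.+1 -> nat).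

Lemma word_eval_rec0 (G : groupType) (g : 'I_k.+1 -> G) :
  word_eval g (power_comm_rec n 0) = g ord0 ^+ n ord0.
Proof. by rewrite /= gmulfXn /= word_eval_gen. Qed.

Lemma word_eval_recS (G : groupType) (g : 'I_k.+1 -> G) j :
  word_eval g (power_comm_rec n j.+1)
  = [~ word_eval g (power_comm_rec n j), g (inord j.+1)] ^+ n (inord j.+1).
Proof. by rewrite /= gmulfXn /= gmulfR /= word_eval_gen. Qed.

Lemma eq_word_eval_rec (G : groupType) (g h : 'I_k.+1 -> G) j :
    j <= k -> (forall v : 'I_k.+1, v <= j -> g v = h v) ->
  word_eval g (power_comm_rec n j) = word_eval h (power_comm_rec n j).
Proof.
elim: j => [|j IHj] le_jk eq_gh; first by rewrite !word_eval_rec0 eq_gh.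
rewrite !word_eval_recS eq_gh ?inordK // IHj 1?ltnW // => v le_vj.
exact/eq_gh/leqW.
Qed.

(** In the step from j to j + 1 the variable with index j + 1 has not been used
    yet, so that its value can be chosen freely. *)
Lemma power_comm_values_image (G : groupType) (gT : finGroupType)
    (K : {group gT}) (f : UMagmaMorphism.type G gT) j x :
    (forall y, reflect (exists z, f z = y) (y \in K)) -> j <= k ->
  x \in power_comm_values K (fun i => n (inord i)) j
  <-> exists g, x = f (word_eval g (power_comm_rec n j)).
Proof.
move=> KP; elim: j x => [|j IHj] x le_jk /=.
  have -> : inord 0 = ord0 :> 'I_k.+1 by apply: val_inj; rewrite /= inordK.
  split=> [/imsetP[_ /KP[z <-] ->] | [g ->]].
    by exists (fun=> z); rewrite word_eval_rec0 gmulfXn.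
  rewrite word_eval_rec0 gmulfXn; apply/imsetP.
  by exists (f (g ord0)) => //; apply/KP; exists (g ord0).
have {}IHj y := IHj y (ltnW le_jk).
split=> [/imset2P[_ _ /IHj[g ->] /KP[z <-] ->] | [g ->]].
  exists (fun v => if v == inord j.+1 then z else g v).
  rewrite word_eval_recS eqxx gmulfXn gmulfR /=.
  congr ([~ f _, _] ^+ _); apply: eq_word_eval_rec => [|v le_vj].
    exact: ltnW.
  by case: eqP => // Dv; move: le_vj; rewrite Dv inordK // ltnn.
rewrite word_eval_recS gmulfXn gmulfR; apply/imset2P.
exists (f (word_eval g (power_comm_rec n j))) (f (g (inord j.+1))) => //.
  by apply/IHj; exists g.
by apply/KP; exists (g (inord j.+1)).
Qed.

(** A nontrivial value of this power would survive in some finite group, where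
    the image of x has an order dividing (2m)! because the image of G has at
    most m values as well. *)
Lemma word_value_expg_fact (G : groupType) (s : seq G) m x :
    residually_finite G ->
    word_values (power_comm_word n) G `<=` [set` s] -> size s <= m ->
    word_values (power_comm_word n) G x ->
  x ^+ (m.*2)`! = 1.
Proof.
move=> rfG sub_s le_s [g _ <-{x}]; apply: contrapT => /rfG[gT [f0 nz_f]].
have f0_1 : f0 1 = 1.
  by apply: (mulgI (f0 1)); rewrite -gmulfM !mulg1.
pose f : UMagmaMorphism.type G gT :=
  HB.pack (f0 : G -> gT) f0 (Multiplicative_isUMagmaMorphism.Build _ _ f0 f0_1).
pose A := [set y : gT | `[< exists z, f z = y >]]%SET.
have AP y : reflect (exists z, f z = y) (y \in A).
  by rewrite inE; exact: asboolP.
have gA : group_set A.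
  apply/group_setP; split=> [|_ _ /AP[y <-] /AP[z <-]].
    by apply/AP; exists 1; rewrite gmulf1.
  by apply/AP; exists (y * z); rewrite gmulfM.
pose K := Group gA; have KP y : reflect (exists z, f z = y) (y \in K) := AP y.
have VP y := power_comm_values_image y KP (leqnn k).
apply: nz_f; change (f (word_eval g (power_comm_word n) ^+ (m.*2)`!) = 1).
rewrite gmulfXn; apply/eqP; rewrite -order_dvdn.
have Vfx : f (word_eval g (power_comm_word n))
    \in power_comm_values K (fun i => n (inord i)) k by apply/VP; exists g.
apply: (order_dvd_fact (power_comm_values_sub Vfx)).
  by move=> e co_e; apply: power_comm_valuesX Vfx.
rewrite -(size_map f s) in le_s; apply: leq_trans le_s.
apply: leq_trans (card_size _).
apply/subset_leq_card/fintype.subsetP => _ /VP[h ->].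
by apply: map_f; apply: sub_s; exists h.
Qed.

End PowerCommWord.

(** * Dietzmann's lemma *)

Lemma size_sum_count (T : eqType) (s r : seq T) :
  {subset r <= s} -> size r <= \sum_(x <- s) count_mem x r.
Proof.
elim: r => // y r IHr sub_yr; rewrite /= big_split /=.
apply: (@leq_add 1); last by apply: IHr => z rz; rewrite sub_yr ?inE ?rz ?orbT.
have sy : y \in s by rewrite sub_yr ?mem_head.
by rewrite (big_rem y) //= eqxx.
Qed.

Lemma prodg_nseq (G : groupType) (x : G) c :
  \prod_(y <- nseq c x) y = x ^+ c.
Proof.
by elim: c => [|c IHc]; rewrite ?big_nil // big_cons IHc expgS.
Qed.

Section Dietzmann.
Variables (G : groupType) (s : seq G).
Hypothesis sJ : forall x c, x \in s -> x ^ c \in s.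

(** Moving occurrences of x to the front replaces the factors y that they pass
    by conjugates of y, which are still in s. *)
Lemma prod_pull x c (r : seq G) :
    {subset r <= s} -> c <= count_mem x r ->
  exists r', [/\ {subset r' <= s}, size r = c + size r'
               & \prod_(y <- r) y = x ^+ c * \prod_(y <- r') y].
Proof.
elim: r c => [|y r IHr] c sub_r.
  by rewrite leqn0 => /eqP->; exists [::]; rewrite expg0 mul1g.
have sub_r' : {subset r <= s} by move=> z rz; rewrite sub_r ?inE ?rz ?orbT.
rewrite /=; case: eqVneq => [Dy|_].
  case: c => [|c]; first by exists (y :: r); rewrite expg0 mul1g.
  rewrite add1n ltnS => /(IHr c sub_r')[r' [sub' -> Dr]].
  by exists r'; rewrite big_cons Dy Dr mulgA -expgS.
rewrite add0n => /(IHr c sub_r')[r' [sub' -> Dr]].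
exists (y ^ (x ^+ c) :: r'); split.
- by apply/allP; rewrite /= sJ ?sub_r ?mem_head //=; apply/allP.
- by rewrite addnS.
by rewrite !big_cons Dr mulgA [y * _]conjgC -mulgA.
Qed.

Variable M : nat.
Hypotheses (M_gt0 : 0 < M) (sM : forall x, x \in s -> x ^+ M = 1).

(** In a product of more than size s * M factors, some x occurs at least M
    times by the pigeonhole principle; pulled to the front, M of these
    occurrences cancel. *)
Lemma prod_shorten (r : seq G) : {subset r <= s} ->
  exists r', [/\ {subset r' <= s}, size r' <= size s * M
               & \prod_(y <- r) y = \prod_(y <- r') y].
Proof.
have [N] := ubnP (size r); elim: N r => // N IHN r ltrN sub_r.
have [le_r|lt_r] := leqP (size r) (size s * M); first by exists r.
have /hasP[x sx le_M] : has (fun x => M <= count_mem x r) s.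
  apply: contraLR lt_r => /hasPn small; rewrite -leqNgt.
  apply: leq_trans (size_sum_count sub_r) _.
  rewrite -sum1_size big_distrl /= !(big_seq_cond predT) leq_sum // => x.
  by rewrite andbT mul1n => /small; rewrite -ltnNge => /ltnW.
have [r1 [sub1 Dsz ->]] := prod_pull sub_r le_M.
rewrite sM // mul1g; apply: IHN => //.
rewrite -ltnS; apply: leq_trans ltrN.
by rewrite ltnS Dsz -[X in X < _]add0n ltn_add2r.
Qed.

Fixpoint products (l : nat) : seq G :=
  if l is l'.+1 then [seq x * y | x <- s, y <- products l'] else [:: 1].

Lemma size_products l : size (products l) = (size s ^ l)%N.
Proof. by elim: l => //= l IHl; rewrite size_allpairs IHl expnS. Qed.

Lemma mem_products (r : seq G) :
  {subset r <= s} -> \prod_(y <- r) y \in products (size r).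
Proof.
elim: r => [|x r IHr] sub_r; first by rewrite big_nil mem_seq1.
rewrite big_cons /=; apply: allpairs_f; first by rewrite sub_r ?mem_head.
by apply: IHr => z rz; rewrite sub_r ?inE ?rz ?orbT.
Qed.

Lemma productsP l x : x \in products l ->
  exists2 r, {subset r <= s} & x = \prod_(y <- r) y.
Proof.
elim: l x => [|l IHl] x /=.
  by rewrite mem_seq1 => /eqP->; exists [::]; rewrite ?big_nil.
case/allpairsP=> -[a b] [/= sa /IHl[r sub_r ->] ->].
exists (a :: r); last by rewrite big_cons.
by apply/allP; rewrite /= sa; apply/allP.
Qed.

(** With 1 in s, a product of at most l factors is one of exactly l factors. *)
Hypothesis s1 : 1 \in s.

Lemma prod_mem_products l (r : seq G) : size s * M <= l ->
  {subset r <= s} -> \prod_(y <- r) y \in products l.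
Proof.
move=> le_l /prod_shorten[r' [sub' le_r' ->]].
have le_r'l := leq_trans le_r' le_l.
have -> : l = size (r' ++ nseq (l - size r') 1).
  by rewrite size_cat size_nseq subnKC.
have -> : \prod_(y <- r') y = \prod_(y <- r' ++ nseq (l - size r') 1) y.
  by rewrite big_cat /= prodg_nseq expg1n mulg1.
apply: mem_products => z.
by rewrite mem_cat => /orP[/sub'//|/nseqP[->]].
Qed.

Lemma products_group_closed l : size s * M <= l ->
  group_closed [in products l].
Proof.
move=> le_l; split=> [|_ _ /productsP[r1 sub1 ->] /productsP[r2 sub2 ->]].
  by have := @prod_mem_products l [::] le_l; rewrite big_nil; apply.
have [r3 sub3 ->] : exists2 r3, {subset r3 <= s} &
    (\prod_(y <- r2) y)^-1 = \prod_(y <- r3) y.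
  elim: r2 sub2 => [|x r IHr] sub_r.
    by exists [::]; rewrite ?big_nil ?invg1.
  have [|r' sub' Dr'] := IHr.
    by move=> z rz; rewrite sub_r ?inE ?rz ?orbT.
  have sx : x \in s by rewrite sub_r ?mem_head.
  (* The inverse of x is its power of exponent M - 1. *)
  exists (r' ++ nseq M.-1 x).
    by move=> z; rewrite mem_cat => /orP[/sub'//|/nseqP[->]].
  rewrite big_cons invgM Dr' big_cat /= prodg_nseq; congr (_ * _).
  by apply: (mulgI x); rewrite mulgV -expgS prednK // sM.
rewrite -big_cat; apply: prod_mem_products => // z.
by rewrite mem_cat => /orP[/sub1|/sub3].
Qed.

End Dietzmann.

(** * Conclusion *)

Lemma card_le_seq (T : choiceType) (A : set T) (t : seq T) nu :
  A `<=` [set` t] -> size t <= nu -> A #<= `I_nu.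
Proof.
move=> At le_t; apply: card_le_trans (subset_card_le At) _.
case: t le_t {At} => [|x0 t] le_t; first by rewrite set_nil card_ge0.
have sub : [set` x0 :: t] `<=` nth x0 (x0 :: t) @` `I_nu.
  move=> x tx; exists (index x (x0 :: t)); last exact: nth_index.
  by apply: leq_trans le_t; rewrite index_mem.
exact: card_le_trans (subset_card_le sub) (card_image_le _ _).
Qed.

Lemma card_le_exists_seq (T : choiceType) (x0 : T) (A : set T) m :
  A #<= `I_m -> exists2 s : seq T, [set` s] = A & size s <= m.
Proof.
move=> leAm; have /finite_seqP[s DA] : finite_set A.
  exact: card_le_finite leAm (finite_II m).
have Du : [set` undup s] = A.
  by rewrite DA; apply/seteqP; split=> x /=; rewrite mem_undup.
exists (undup s) => //; rewrite -(card_le_II (size (undup s)) m).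
apply: card_le_trans leAm; rewrite -Du.
apply: card_le_trans (card_image_le (index^~ (undup s)) _).
apply: subset_card_le => i /= lt_i.
exists (nth x0 (undup s) i); first exact: mem_nth.
by rewrite index_uniq ?undup_uniq.
Qed.

Theorem corollary4 :
  forall m : nat, (0 < m)%N ->
  exists nu : nat,
  forall (k : nat) (n : 'I_k.+1 -> nat),
    (forall i : 'I_k.+1, (0 < n i)%N) ->
  forall G : groupType,
    residually_finite G ->
    word_values (power_comm_word n) G #<= `I_m ->
    finite_set (verbal_subgroup (power_comm_word n) G) /\
    verbal_subgroup (power_comm_word n) G #<= `I_nu.
Proof.
move=> m m_gt0; pose M := (m.*2)`!; pose l := (m * M)%N.
have M_gt0 : 0 < M := fact_gt0 _.
exists (m ^ l)%N => k n _ G rfG /(card_le_exists_seq 1)[s Ds le_s].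
suff [t Vt le_t] : exists2 t : seq G,
    verbal_subgroup (power_comm_word n) G `<=` [set` t] & size t <= m ^ l.
  split; last exact: card_le_seq Vt le_t.
  by apply: sub_finite_set Vt (finite_seq t).
have sP x : x \in s <-> word_values (power_comm_word n) G x by rewrite -Ds.
have sJ x c : x \in s -> x ^ c \in s by move=> /sP sx; apply/sP/word_valuesJ.
have sM x : x \in s -> x ^+ M = 1.
  by move=> /sP; apply: word_value_expg_fact rfG _ le_s; rewrite Ds.
have s1 : 1 \in s by apply/sP/word_values1.
exists (products s l); last first.
  by rewrite size_products leq_exp2r // muln_gt0 m_gt0.
apply: smallest_sub.
  have [|t1 tB] := @products_group_closed _ _ sJ _ M_gt0 sM s1 l.
    by rewrite leq_mul2r le_s orbT.
  have inT y : (y \in mem [set` products s l]) = (y \in products s l).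
    by apply/idP/idP; rewrite inE.
  by split=> [|x y]; rewrite !inT //; apply: tB.
move=> x /sP sx; have := @prod_mem_products _ _ sJ _ M_gt0 sM s1 l [:: x].
rewrite big_seq1; apply; first by rewrite leq_mul2r le_s orbT.
by move=> y; rewrite mem_seq1 => /eqP->.
Qed.
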